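(* Let $K$ be a field of characteristic $0$, $n\ge 2$, and let $f=\sum a_{i_1,\dots,i_n}x_1^{i_1}\cdots x_n^{i_n}\in K[[x_1,\dots,x_n]]$ be D-finite over $K(x_1,\dots,x_n)$. For each $i\in\{1,\dots,n\}$ fix a non-zero $L_i\in K[x_1,\dots,x_n]\langle D_{x_i}\rangle$ with $L_i(f)=0$, of order $r_i$ and degree $d_i$; let $r_f=\max_i r_i$, $d_f=\max_i d_i$. Write $t$ for $x_2$ and let $$\Delta_{2,1}(f)=\sum_{i_1,i_3,\dots,i_n\ge0}a_{i_1,i_1,i_3,\dots,i_n}\,t^{i_1}x_3^{i_3}\cdots x_n^{i_n}\in K[[t,x_3,\dots,x_n]].$$ Then there exists a non-zero operator $P_\alpha\in K[t,x_3,\dots,x_n]\langle D_t\rangle$ with $P_\alpha(\Delta_{2,1}(f))=0$ and $$\deg(P_\alpha)\le 8(d_1+d_2+1)^2(r_1r_2)^2\bigl(8(d_1+d_2+1)^2r_1r_2+1\bigr)=O(d_f^4r_f^6),\qquad \operatorname{ord}(P_\alpha)\le 4(d_1+d_2+1)r_1r_2=O(d_fr_f^2),$$ and for each $h\in\{3,\dots,n\}$ there exists a non-zero operator $P_{h,\alpha_h}\in K[t,x_3,\dots,x_n]\langle D_{x_h}\rangle$ with $P_{h,\alpha_h}(\Delta_{2,1}(f))=0$ and $$\deg(P_{h,\alpha_h})\le 8(d_1+d_2+d_h+1)^2(r_1r_2r_h)^2\bigl(8(d_1+d_2+d_h+1)^2r_1r_2r_h+1\bigr)=O(d_f^4r_f^9),$$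 $$\operatorname{ord}(P_{h,\alpha_h})\le 4(d_1+d_2+d_h+1)r_1r_2r_h=O(d_fr_f^3).$$
   Context: A series $g\in K[[x_1,\dots,x_n]]$ is D-finite over $K(x_1,\dots,x_n)$ if the $K(x_1,\dots,x_n)$-vector space spanned in $K(x_1,\dots,x_n)\otimes_{K[x_1,\dots,x_n]}K[[x_1,\dots,x_n]]$ by all partial derivatives of $g$ is finite-dimensional. For an operator $L=\sum_{j=0}^{r}\ell_j D_{y}^j$ in a single derivation $D_y$ with polynomial coefficients and $\ell_r\neq 0$, its order is $r$ and its degree is the maximum total degree (in all variables) of the coefficients $\ell_j$. *)

(* Defs.v *)
From mathcomp Require Import all_boot all_order all_algebra.
From mathcomp Require Import mpoly.
Set Implicit Arguments. Unset Strict Implicit. Unset Printing Implicit Defensive.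
Import Order.TTheory GRing.Theory.
Local Open Scope ring_scope.

Section Defs.
Variables (K : fieldType) (n : nat).

(* Formal power series in x_1..x_n (0-based variable indices 0..n-1):
   a power series is its coefficient function on monomials. *)
Definition series := 'X_{1..n} -> K.

Definition mexp (m : 'X_{1..n}) (j : nat) : nat :=
  (\sum_(i < n | (i : nat) == j) m i)%N.

Definition mshift (m : 'X_{1..n}) (j : nat) : 'X_{1..n} :=
  [multinom (m i + ((i : nat) == j))%N | i < n].

Definition sderiv (j : nat) (g : series) : series :=
  fun m => ((mexp m j).+1)%:R * g (mshift m j).

Definition mulps (p : {mpoly K[n]}) (g : series) : series :=
  fun m => \sum_(u <- msupp p) (if (u <= m)%MM then p@_u * g (m - u)%MM else 0).

Definition addps (g h : series) : series := fun m => g m + h m.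

Definition zerops : series := fun _ => 0.

(* An operator L = \sum_k l_k D_{x_j}^k in K[x_1..x_n]<D_{x_j}> is represented by
   its coefficient list (l_0, ..., l_r) stored as a polynomial in D:
   L`_k = l_k.  L != 0 iff the operator is non-zero; its order is (size L).-1. *)
Definition op := {poly {mpoly K[n]}}.

Definition opapply (L : op) (j : nat) (g : series) : series :=
  fun m => \sum_(k < size L) mulps L`_k (iter k (sderiv j) g) m.

Definition oporder (L : op) : nat := (size L).-1.

Definition opdeg (L : op) : nat := (\max_(k < size L) (msize L`_k).-1)%N.

Definition pderiv (a : 'X_{1..n}) (g : series) : series :=
  foldr (fun i h => iter (a i) (sderiv i) h) g (enum 'I_n).

(* D-finiteness: the K(x)-span of all partial derivatives of g in
   K(x) (x)_{K[x]} K[[x]] is finite-dimensional, i.e. for some N every N+1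
   partial derivatives are K(x)-linearly dependent; since K[[x]] is a
   torsion-free K[x]-module this is K[x]-linear dependence inside K[[x]]. *)
Definition Dfinite (g : series) : Prop :=
  exists N : nat, forall a : 'I_N.+1 -> 'X_{1..n},
    exists p : 'I_N.+1 -> {mpoly K[n]},
      (exists j, p j != 0) /\
      (fun m => \sum_(j < N.+1) mulps (p j) (pderiv (a j) g) m) = zerops.

End Defs.

(* The diagonal Delta_{2,1}: for f in K[[x_1..x_n]] (n >= 2) the series in
   (t, x_3, ..., x_n) (n-1 variables, t has index 0, x_{h} has index h-2)
   with coefficient of t^{i1} x_3^{i3}..x_n^{in} equal to a_{i1,i1,i3,..,in}. *)
Definition diag21 (K : fieldType) (n : nat) (f : series K n) : series K n.-1 :=
  fun m => f [multinom (if (i : nat) == 0%N then mexp m 0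
                        else mexp m (i : nat).-1) | i < n].

(* Main.v *)
Require Import Defs.
From HB Require Import structures.
From mathcomp Require Import all_boot all_order all_algebra.
From mathcomp Require Import mpoly.
From mathcomp Require boolp.
From mathcomp Require Import zify ring.
Set Implicit Arguments. Unset Strict Implicit. Unset Printing Implicit Defensive.
Import Order.TTheory GRing.Theory.
Local Open Scope ring_scope.

(* Put F = f(s, t/s, x_3, ...) / s, so that the diagonal of f is the residue of
   F in s.  The derivatives D_s^i D^k F with i + k <= M, where D is D_t or
   D_(x_h), have a common denominator and coordinates, over the R derivatives of
   f below the orders r_i, of degree O(M) in s and in (t, x_3, ...).  There are
   about M^2/2 of them and O(M R) coefficients of powers of s, so for
   M = 4 (d_1 + d_2 + ... + 1) R they satisfy a relation with coefficients free of
   s, of degree bounded by Cramer's rule.  Writing it as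
   D_s^i (P + D_s Q) F = 0 with P free of D_s and nonzero, and taking residues,
   shows that P annihilates the diagonal. *)

(** * Power series as a module over the polynomials *)

Section SeriesModule.
Variables (K : fieldType) (n : nat).
Implicit Types (p q G : {mpoly K[n]}) (m u a b : 'X_{1..n}).

Definition mser := series K n.

(** Given in closed form with falling factorials, to match [mderivm] coefficient by coefficient;
    [dserMn_sderiv] links it to iterates of [sderiv]. *)
Definition dser a (g : mser) : mser :=
  fun m => (\prod_(i < n) (a + m)%MM i ^_ a i)%:R * g (a + m)%MM.

(* Identities between series reduce to identities between polynomials that
   agree with them below an arbitrary degree. *)
Definition agree k G (g : mser) := forall m, (mdeg m < k)%N -> G@_m = g m.

Lemma agree_exists k (g : mser) : exists G, agree k G g.
Proof.
by exists (\sum_(m : 'X_{1..n < k}) g m *: 'X_[m]) => m mk; rewrite mcoeff_mpoly.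
Qed.

Lemma mcoeffXM p u m :
  ('X_[u] * p)@_m = if (u <= m)%MM then p@_(m - u) else 0.
Proof.
case: ifP => um; first by rewrite mulrC -[in LHS](submK um) addmC mcoeffMX.
apply/eqP; rewrite mcoeff_eq0; apply/negP => mX.
have := perm_mem (msuppMX p u) m; rewrite mulrC mX => /esym/mapP[v _ mE].
by rewrite mE lem_addr in um.
Qed.

Lemma agree_mulps k p G g : agree k G g -> agree k (p * G) (mulps p g).
Proof.
move=> Gg m mk; rewrite {1}[p]mpolyE mulr_suml raddf_sum /=.
apply: eq_bigr => u _; rewrite -scalerAl mcoeffZ mcoeffXM.
case: ifP => um; last by rewrite mulr0.
by rewrite Gg // (leq_ltn_trans _ mk) // mdegB.
Qed.

Lemma agree_dser k a G g :
  agree (mdeg a + k) G g -> agree k G^`M[a] (dser a g).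
Proof.
move=> Gg m mk; rewrite mcoeff_mderivm Gg ?mdegD ?ltn_add2l //.
by rewrite -[LHS]mulr_natl.
Qed.

Lemma agree_addps k G H g h :
  agree k G g -> agree k H h -> agree k (G + H) (addps g h).
Proof. by move=> Gg Hh m mk; rewrite mcoeffD Gg ?Hh. Qed.

Lemma agree_leq k l G g : (k <= l)%N -> agree l G g -> agree k G g.
Proof. by move=> kl Gg m mk; apply: Gg; apply: leq_trans kl. Qed.

Lemma agree_eq (g h : mser) :
  (forall k, exists2 G, agree k G g & agree k G h) -> g = h.
Proof.
move=> gh; apply: boolp.funext => m.
by have [G Gg Gh] := gh (mdeg m).+1; rewrite -Gg // Gh.
Qed.

HB.instance Definition _ := boolp.gen_eqMixin mser.
HB.instance Definition _ := boolp.gen_choiceMixin mser.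

Definition mser_opp (g : mser) : mser := fun m => - g m.

Lemma mser_addA : associative (@addps K n).
Proof. by move=> g h l; apply: boolp.funext => m; apply: addrA. Qed.
Lemma mser_addC : commutative (@addps K n).
Proof. by move=> g h; apply: boolp.funext => m; apply: addrC. Qed.
Lemma mser_add0 : left_id (@zerops K n) (@addps K n).
Proof. by move=> g; apply: boolp.funext => m; apply: add0r. Qed.
Lemma mser_addN : left_inverse (@zerops K n) mser_opp (@addps K n).
Proof. by move=> g; apply: boolp.funext => m; apply: addNr. Qed.

HB.instance Definition _ :=
  GRing.isZmodule.Build mser mser_addA mser_addC mser_add0 mser_addN.

Lemma mulps_mulA p q g : mulps p (mulps q g) = mulps (p * q) g.
Proof.
apply: agree_eq => k; have [G Gg] := agree_exists k g.
exists (p * q * G); last exact: agree_mulps.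
by rewrite -mulrA; do 2!apply: agree_mulps.
Qed.

Lemma mulps_1 : left_id 1 (@mulps K n).
Proof.
move=> g; apply: agree_eq => k; have [G Gg] := agree_exists k g.
by exists (1 * G); [exact: agree_mulps | rewrite mul1r].
Qed.

Lemma mulps_Dr : right_distributive (@mulps K n) (@addps K n).
Proof.
move=> p g h; apply: agree_eq => k.
have [[G Gg] [H Hh]] := (agree_exists k g, agree_exists k h).
exists (p * (G + H)); first exact/agree_mulps/agree_addps.
by rewrite mulrDr; apply: agree_addps; apply: agree_mulps.
Qed.

Lemma mulps_Dl (g : mser) :
  {morph (fun p => mulps p g) : p q / p + q >-> addps p q}.
Proof.
move=> p q; apply: agree_eq => k; have [G Gg] := agree_exists k g.
exists ((p + q) * G); first exact/agree_mulps.
by rewrite mulrDl; apply: agree_addps; apply: agree_mulps.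
Qed.

HB.instance Definition _ := GRing.Zmodule_isLmodule.Build {mpoly K[n]} mser
  mulps_mulA mulps_1 mulps_Dr mulps_Dl.

Lemma mser_scaleE p (g : mser) : p *: g = mulps p g. Proof. by []. Qed.
Lemma mserDE (g h : mser) m : (g + h) m = g m + h m. Proof. by []. Qed.
Lemma mserNE (g : mser) m : (- g) m = - g m. Proof. by []. Qed.
Lemma mser0E m : (0 : mser) m = 0. Proof. by []. Qed.

Lemma mser_sumE I (r : seq I) (P : pred I) (F : I -> mser) m :
  (\sum_(i <- r | P i) F i) m = \sum_(i <- r | P i) F i m.
Proof. by elim/big_rec2: _ => // i x y _ <-. Qed.

Lemma mser_scaleXE u (g : mser) m :
  ('X_[u] *: g) m = if (u <= m)%MM then g (m - u)%MM else 0.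
Proof.
by rewrite mser_scaleE /mulps msuppX big_seq1 mcoeffX eqxx mul1r.
Qed.

Lemma mser_scaleCE c (g : mser) m : (c%:MP *: g) m = c * g m.
Proof.
have [G Gg] := agree_exists (mdeg m).+1 g.
by rewrite mser_scaleE -(agree_mulps _ Gg) // mcoeffCM Gg.
Qed.

(** Compare coefficients at [m + mlast p], where [mlast p] is the least monomial of [p]: every other
    monomial of [p] meets a coefficient of [g] at an index below [m], which is zero by induction. *)
Lemma mser_scale_eq0 p (g : mser) : p != 0 -> p *: g = 0 -> g = 0.
Proof.
move=> p0 pg0; apply: boolp.funext => m; rewrite mser0E.
elim/(well_founded_induction (@ltom_wf n)): m => m IHm.
have := congr1 (fun h : mser => h (m + mlast p)%MM) pg0.
rewrite mser_scaleE /mulps (bigD1_seq (mlast p)) ?mlast_supp ?msupp_uniq //=.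
rewrite lem_addl addmK big1_seq => [|u /andP[ul up]].
  rewrite addr0 => /eqP; rewrite mulf_eq0 mcoeff_eq0 mlast_supp //=.
  by move/eqP.
case: ifP => // um; rewrite IHm ?mulr0 //.
rewrite -(ltmc_add2l _ _ u) (submK um) ltmc_add2r lt_neqAle eq_sym ul.
exact: mlast_lemc.
Qed.

Lemma dserD a : {morph dser a : g h / g + h}.
Proof. by move=> g h; apply: boolp.funext => m; apply: mulrDr. Qed.

Lemma dser0 a : dser a 0 = 0.
Proof. by apply: boolp.funext => m; apply: mulr0. Qed.

HB.instance Definition _ a := GRing.isNmodMorphism.Build mser mser (dser a)
  (conj (dser0 a) (dserD a)).

Lemma dserDm a b g : dser (a + b) g = dser b (dser a g).
Proof.
apply: agree_eq => k; have [G Gg] := agree_exists (mdeg (a + b) + k) g.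
exists G^`M[a + b]; first exact: agree_dser.
by rewrite mderivmDm; do 2!apply: agree_dser; rewrite addnA -mdegD.
Qed.

Lemma dser0m g : dser 0 g = g.
Proof.
apply: agree_eq => k; have [G Gg] := agree_exists k g.
exists G^`M[0]; last by rewrite mderivm0m.
by apply: agree_dser; rewrite mdeg0.
Qed.

Lemma dserUZ i p (g : mser) :
  dser U_(i) (p *: g) = p^`M(i) *: g + p *: dser U_(i) g.
Proof.
apply: agree_eq => k; have [G Gg] := agree_exists k.+1 g.
exists (p * G)^`M[U_(i)].
  by apply: agree_dser; rewrite mdeg1; apply: agree_mulps.
rewrite mderivmU1m mderivM; apply: agree_addps; apply: agree_mulps.
  exact: agree_leq Gg.
by rewrite -mderivmU1m; apply: agree_dser; rewrite mdeg1.
Qed.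

Lemma dserU_sderiv (i : 'I_n) g : dser U_(i) g = sderiv i g.
Proof.
apply: boolp.funext => m; rewrite /dser /sderiv /mexp.
have -> : (U_(i) + m = mshift m i)%MM.
  by apply/mnmP => j; rewrite mnmDE mnm1E mnmE addnC eq_sym.
congr (_%:R * _); rewrite (bigD1 i) //= big1 => [|j ji].
  rewrite (eq_bigl (pred1 i)) ?big_pred1_eq //.
  by rewrite mnm1E mnmE !eqxx addn1 ffactn1 muln1.
by rewrite mnm1E eq_sym (negPf ji) ffactn0.
Qed.

Lemma dserMn_sderiv (i : 'I_n) k g :
  dser (U_(i) *+ k) g = iter k (sderiv i) g.
Proof.
elim: k => [|k IHk]; first by rewrite mulm0n dser0m.
by rewrite mulmSr dserDm IHk dserU_sderiv.
Qed.

Lemma opapplyE (P : op K n) (i : 'I_n) g :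
  opapply P i g = \sum_(k < size P) P`_k *: dser (U_(i) *+ k) g :> mser.
Proof.
apply: boolp.funext => m; rewrite mser_sumE; apply: eq_bigr => k _.
by rewrite dserMn_sderiv.
Qed.

End SeriesModule.

(** * Degrees and bounded syzygies *)

(* Cramer's rule on a maximal nonvanishing minor and one further column. *)
Lemma mulmx_kernel_minors (R : idomainType) (m n : nat) (A : 'M[R]_(m, n)) :
  (m < n)%N -> exists v : 'cV[R]_n, [/\ v != 0, A *m v = 0 &
    forall i, v i 0 = 0 \/ exists k (b : nat) (f : 'I_k -> 'I_m) (g : 'I_k -> 'I_n),
      (k <= m)%N /\ v i 0 = (-1) ^+ b * \det (mxsub f g A)].
Proof.
move=> mn; pose A' := map_mx (@tofrac R) A; pose k := \rank A'.
have km : (k <= m)%N by apply: rank_leq_row.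
pose f := maxrankfun A'; pose B := rowsub f A'.
have rkBT : row_full B^T.
  by rewrite /row_full mxrank_tr; have := maxrowsub_free A'.
pose g0 := fullrankfun rkBT.
(* [f] picks [k] independent rows of [A'] and [g0] picks [k] independent columns among these
   rows. *)
have detg0 : \det (mxsub f g0 A) != 0.
  have := fullrowsub_unit rkBT; rewrite unitmxE unitfE -det_tr.
  have -> : (rowsub g0 B^T)^T = map_mx (@tofrac R) (mxsub f g0 A).
    by apply/matrixP => i j; rewrite !mxE.
  by rewrite det_map_mx /= tofrac_eq0.
(* [g0] uses only [k <= m < n] columns, so a further one remains. *)
have [j0 j0g] : exists j0, j0 \notin codom g0.
  apply/existsP; rewrite -negb_forall; apply/negP => /forallP gT.
  have : (#|'I_n| <= #|codom g0|)%N.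
    by apply/subset_leq_card/subsetP => j _; apply: gT.
  have g0_inj : injective g0 by apply: fullrankfun_inj.
  by rewrite (card_codom g0_inj) !card_ord leqNgt (leq_ltn_trans km).
pose ext (T : Type) (x : T) (h : 'I_k -> T) (i : 'I_k.+1) :=
  if unlift ord0 i is Some i' then h i' else x.
have ext0 T x h : ext T x h ord0 = x by rewrite /ext unlift_none.
have extS T x h i : ext T x h (lift ord0 i) = h i by rewrite /ext liftK.
pose g := ext _ j0 g0.
have g_inj : injective g.
  move=> i j; case: (unliftP ord0 i) => [i'|] ->; case: (unliftP ord0 j) => [j'|] ->;
    rewrite /g ?ext0 ?extS => // gij.
  - by congr lift; apply: fullrankfun_inj gij.
  - by rewrite -gij codom_f in j0g.
  - by rewrite gij codom_f in j0g.
pose w (j : 'I_k.+1) := (-1) ^+ j * \det (mxsub f (g \o lift j) A).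
have Aw r : \sum_j A r (g j) * w j = 0.
  (* Row [r] placed above the rows [f] gives a matrix of size [k + 1], larger than the rank of [A'],
     hence singular. Its cofactors along that row are the [w j], which do not depend on [r]. *)
  pose M := mxsub (ext _ r f) g A.
  have detM : \det M = 0.
    apply/eqP; rewrite -(tofrac_eq0) -det_map_mx; apply/negPn/negP => dM.
    have : row_free (map_mx (@tofrac R) M) by rewrite row_free_unit unitmxE unitfE.
    have -> : map_mx (@tofrac R) M = mxsub (ext _ r f) g A'.
      by apply/matrixP => i j; rewrite !mxE.
    have -> : mxsub (ext _ r f) g A' = rowsub (ext _ r f) 1%:M *m (A' *m colsub g 1%:M).
      by rewrite mulmx_colsub mulmx1 mul_rowsub_mx mul1mx -mxsub_comp.
    rewrite /row_free => /eqP rkM.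
    have := mxrankM_maxr (rowsub (ext _ r f) 1%:M) (A' *m colsub g 1%:M).
    by rewrite rkM => /leq_trans/(_ (mxrankM_maxl _ _)); rewrite ltnn.
  rewrite -[RHS]detM [RHS](expand_det_row M ord0); apply: eq_bigr => j _.
  rewrite !mxE ext0; congr (_ * _); rewrite /cofactor add0n; congr (_ * \det _).
  by apply/matrixP => i l; rewrite !mxE extS.
(* The minors are placed at the columns in the image of [g], with zero elsewhere; the entry at [j0]
   is the nonzero minor. *)
exists (\col_i \sum_(j | g j == i) w j); split.
- apply/eqP => /colP/(_ j0); rewrite !mxE.
  rewrite (eq_bigl (pred1 ord0)) ?big_pred1_eq => [|j]; last first.
    by rewrite /= -(inj_eq g_inj) /g ext0.
  rewrite /w expr0 mul1r => /eqP; rewrite (_ : mxsub _ _ _ = mxsub f g0 A).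
    by rewrite (negPf detg0).
  by apply/matrixP => i l; rewrite !mxE /g /= extS.
- apply/colP => r; rewrite !mxE -[RHS](Aw r) [RHS](partition_big g predT) //=.
  apply: eq_bigr => i _; rewrite mxE mulr_sumr.
  by apply: eq_bigr => j /eqP ->.
move=> i; case: (pickP (fun j => g j == i)) => [j /eqP gj|gi]; last first.
  by left; rewrite mxE big_pred0.
right; exists k, j, f, (g \o lift j); split=> //.
rewrite mxE (eq_bigl (pred1 j)) ?big_pred1_eq // => l.
by rewrite /= -gj (inj_eq g_inj).
Qed.

Section Degree.
Variables (K : fieldType) (n : nat).
Implicit Types (p q : {mpoly K[n]}).

(** Since [msize] is one more than the degree and vanishes at 0, the zero polynomial meets every
    bound. *)
Definition degle (d : nat) p := (msize p <= d.+1)%N.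

Lemma degleP d p : reflect (forall m, p@_m != 0 -> (mdeg m <= d)%N) (degle d p).
Proof.
apply: (iffP idP) => [dp m|dp].
  by rewrite -mcoeff_msupp => /msize_mdeg_lt mp; rewrite -ltnS (leq_trans mp).
rewrite /degle msizeE big_seq; apply/bigmax_leqP_seq => m mp _.
by rewrite ltnS dp // -mcoeff_msupp.
Qed.

Lemma degle_leq d e p : (d <= e)%N -> degle d p -> degle e p.
Proof. by move=> de dp; apply: leq_trans dp _; rewrite ltnS. Qed.

Lemma degle0 d : degle d 0. Proof. by rewrite /degle msize0. Qed.

Lemma degleC d c : degle d c%:MP.
Proof. by rewrite /degle msizeC; case: (_ == _). Qed.

Lemma degleX m : degle (mdeg m) 'X_[m].
Proof. by rewrite /degle msizeX. Qed.

Lemma degleD d p q : degle d p -> degle d q -> degle d (p + q).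
Proof.
by move=> dp dq; apply: leq_trans (msizeD_le _ _) _; rewrite geq_max; apply/andP.
Qed.

Lemma degleN d p : degle d (- p) = degle d p.
Proof. by rewrite /degle msizeN. Qed.

Lemma degle_sum d I (r : seq I) (P : pred I) F :
  (forall i, P i -> degle d (F i)) -> degle d (\sum_(i <- r | P i) F i).
Proof.
move=> dF; apply: (big_ind (degle d)) => //; first exact: degle0.
by move=> p q; apply: degleD.
Qed.

Lemma degleM d e p q : degle d p -> degle e q -> degle (d + e) (p * q).
Proof.
move=> dp dq.
have [->|p0] := eqVneq p 0; first by rewrite mul0r degle0.
have [->|q0] := eqVneq q 0; first by rewrite mulr0 degle0.
rewrite /degle msizeM //.
have pred_add (a b : nat) : (a <= d.+1 -> b <= e.+1 -> (a + b).-1 <= (d + e).+1)%N by lia.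
exact: pred_add.
Qed.

Lemma degle_prod d I (r : seq I) (P : pred I) (e : I -> nat) F :
  (forall i, P i -> degle (e i) (F i)) -> (\sum_(i <- r | P i) e i <= d)%N ->
  degle d (\prod_(i <- r | P i) F i).
Proof.
move=> dF sd; apply: degle_leq sd _; elim/big_rec2: _ => [|i p e' Pi].
  by rewrite -mpolyC1 degleC.
by apply: degleM; apply: dF.
Qed.

Lemma degleXn d k p : degle d p -> degle (k * d) (p ^+ k).
Proof.
move=> dp; elim: k => [|k IHk]; first by rewrite expr0 -mpolyC1 degleC.
by rewrite exprS mulSn degleM.
Qed.

Lemma degle_deriv d i p : degle d p -> degle d p^`M(i).
Proof.
move=> /degleP dp; apply/degleP => m; rewrite mcoeff_deriv => pm.
have /dp : p@_(m + U_(i)) != 0 by apply: contraNneq pm => ->; rewrite mul0rn.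
by apply: leq_trans; rewrite mdegD leq_addr.
Qed.

Lemma degle_det d k (A : 'M[{mpoly K[n]}]_k) :
  (forall i j, degle d (A i j)) -> degle (k * d) (\det A).
Proof.
move=> dA; apply: degle_sum => s _; rewrite -[X in degle X]add0n; apply: degleM.
  by rewrite -signr_odd; case: odd; rewrite ?expr1 ?degleN -mpolyC1 degleC.
by apply: degle_prod => [i _|]; [apply: dA | rewrite sum_nat_const card_ord].
Qed.

(** The kernel vector has entries that are zero or signed minors of size at most [#|I|]; such a
    minor is a sum of products of at most [#|I|] entries of degree at most [d]. *)
Lemma small_syzygy (I J : finType) d (A : I -> J -> {mpoly K[n]}) :
  (#|I| < #|J|)%N -> (forall i j, degle d (A i j)) ->
  exists v : J -> {mpoly K[n]}, [/\ exists j, v j != 0,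
    forall j, degle (#|I| * d) (v j) & forall i, \sum_j A i j * v j = 0].
Proof.
move=> IJ dA.
pose M := \matrix_(i < #|I|, j < #|J|) A (enum_val i) (enum_val j).
have [v [v0 Mv vP]] := mulmx_kernel_minors M IJ.
exists (fun j => v (enum_rank j) 0); split.
- have /cV0Pn[j vj] := v0; exists (enum_val j).
  by rewrite enum_valK.
- move=> j; case: (vP (enum_rank j)) => [->|]; first exact: degle0.
  case=> k [b] [f] [g] [kI ->]; rewrite -signr_odd -[(_ * d)%N]add0n.
  apply: degleM.
    by case: odd; rewrite ?expr1 ?degleN -mpolyC1 degleC.
  apply: (@degle_leq (k * d)); first by rewrite leq_mul2r kI orbT.
  by apply: degle_det => i l; rewrite !mxE.
move=> i; have /colP/(_ (enum_rank i)) := Mv; rewrite !mxE => Mvi.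
rewrite -[RHS]Mvi (reindex (enum_val : 'I_#|J| -> J)) /=; last first.
  exact/onW_bij/enum_val_bij.
by apply: eq_bigr => j _; rewrite mxE enum_rankK enum_valK.
Qed.

End Degree.

(** * Reduction of derivatives *)

Section Span.
Variables (K : fieldType) (n : nat) (f : mser K n).
Implicit Types (A B : 'X_{1..n} -> Prop) (g h : mser K n) (a b : 'X_{1..n}).

(** Terms are added one at a time, so [A] may be infinite and indices may repeat; [span_finite]
    collects them over a finite family. *)
Inductive dspan A (d : nat) : mser K n -> Prop :=
| span0 : dspan A d 0
| span_cons c a g :
    A a -> degle d c -> dspan A d g -> dspan A d (c *: dser a f + g).

Lemma spanD A d g h : dspan A d g -> dspan A d h -> dspan A d (g + h).
Proof.
by elim=> [|c a g' Aa dc _ IH] hh; rewrite ?add0r // -addrA; apply: span_cons (IH hh).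
Qed.

Lemma span1 A d c a : A a -> degle d c -> dspan A d (c *: dser a f).
Proof. by move=> Aa dc; rewrite -[_ *: _]addr0; apply: span_cons => //; apply: span0. Qed.

Lemma span_sum A d I (r : seq I) (P : pred I) (F : I -> mser K n) :
  (forall i, P i -> dspan A d (F i)) -> dspan A d (\sum_(i <- r | P i) F i).
Proof.
move=> AF; apply: (big_ind (dspan A d)) => //; first exact: span0.
by move=> ? ?; apply: spanD.
Qed.

Lemma span_sub A B d e g : (forall a, A a -> B a) -> (d <= e)%N ->
  dspan A d g -> dspan B e g.
Proof.
move=> AB de; elim=> [|c a h Aa dc _ IH]; first exact: span0.
by apply: span_cons => //; [exact: AB | exact: degle_leq dc].
Qed.

(** [q] acts as a common denominator: one factor [q] suffices to rewrite all the generators indexed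
    by [A] over [B], and degrees add. *)
Lemma span_trans A B d e q g :
    (forall a, A a -> dspan B e (q *: dser a f)) -> dspan A d g ->
  dspan B (d + e) (q *: g).
Proof.
have scale c h : degle d c -> dspan B e h -> dspan B (d + e) (c *: h).
  move=> dc; elim=> [|c' a h' Ba dc' _ IH]; first by rewrite scaler0; apply: span0.
  by rewrite scalerDr scalerA; apply: span_cons => //; apply: degleM.
move=> AB; elim=> [|c a h Aa dc _ IH]; first by rewrite scaler0; apply: span0.
rewrite scalerDr; apply: spanD => //.
by rewrite scalerA mulrC -scalerA; apply: scale => //; apply: AB.
Qed.

Lemma span_scale A d e q g :
  degle e q -> dspan A d g -> dspan A (d + e) (q *: g).
Proof. by move=> dq; apply: span_trans => a Aa; apply: span1. Qed.

Lemma spanN A d g : dspan A d g -> dspan A d (- g).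
Proof.
move=> gA; rewrite -scaleN1r -[d]addn0; apply: span_scale gA.
by rewrite degleN -mpolyC1 degleC.
Qed.

(** By Leibniz, the derivative falls on the coefficient, whose degree does not grow, or raises the
    index by [U_(i)]. *)
Lemma span_dser A B d i g :
    (forall a, A a -> B a /\ B (a + U_(i))%MM) -> dspan A d g ->
  dspan B d (dser U_(i) g).
Proof.
move=> AB; elim=> [|c a h Aa dc _ IH]; first by rewrite dser0; apply: span0.
have [Ba Bai] := AB a Aa.
rewrite dserD dserUZ -dserDm -addrA; apply: span_cons => //.
  exact: degle_deriv.
exact: span_cons.
Qed.

Lemma span_finite A d (I : finType) (e : I -> 'X_{1..n}) g :
    (forall a, A a -> exists i, e i = a) -> dspan A d g ->
  exists C : I -> {mpoly K[n]},
    (forall i, degle d (C i)) /\ g = \sum_i C i *: dser (e i) f.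
Proof.
move=> eA; elim=> [|c a h Aa dc _ [C [dC ->]]].
  exists (fun=> 0); split=> [i|]; first exact: degle0.
  by rewrite big1 // => i _; rewrite scale0r.
have [i0 <-] := eA a Aa.
exists (fun i => (if i == i0 then c else 0) + C i); split=> [i|].
  by apply: degleD => //; case: eqP => // _; apply: degle0.
under [in RHS]eq_bigr do rewrite scalerDl.
rewrite big_split /= [X in _ = X + _](bigD1 i0) //= eqxx.
rewrite [X in _ = _ + X + _]big1 ?addr0 // => i /negPf ->.
by rewrite scale0r.
Qed.

(** * Reduction of derivatives below the orders of the operators *)

Section Reduction.
Variables (J : {set 'I_n}) (L : 'I_n -> op K n) (d : 'I_n -> nat).
Hypothesis L_gt1 : forall i, i \in J -> (1 < size (L i))%N.
Hypothesis L_deg : forall i k, i \in J -> degle (d i) (L i)`_k.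
Hypothesis Lf : forall i, i \in J ->
  \sum_(k < size (L i)) (L i)`_k *: dser (U_(i) *+ k) f = 0.

Definition supported a := forall i, i \notin J -> a i = 0%N.

Lemma supportedD a b : supported a -> supported b -> supported (a + b)%MM.
Proof. by move=> sa sb i iJ; rewrite mnmDE sa ?sb. Qed.

Lemma supportedU i k : i \in J -> supported (U_(i) *+ k)%MM.
Proof.
move=> iJ j jJ; rewrite mulmnE mnm1E; case: eqP => // ij.
by rewrite -ij iJ in jJ.
Qed.

Lemma supportedU1 i : i \in J -> supported U_(i)%MM.
Proof. by move=> iJ; rewrite -[U_(i)%MM]mulm1n; apply: supportedU. Qed.

Lemma supportedB a b : supported a -> supported (a - b)%MM.
Proof. by move=> sa i iJ; rewrite mnmBE sa. Qed.

Definition low m a := supported a /\ (mdeg a < m)%N.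

(** Differentiating the equation of [L i] along [a] and isolating the top derivative leaves terms of
    smaller total order. The Leibniz terms never raise degrees, so the bound [d i] is independent of
    [a]. *)
Lemma span_lead_coef i a : i \in J -> supported a ->
  dspan (low (mdeg a + oporder (L i))) (d i)
    (lead_coef (L i) *: dser (a + U_(i) *+ oporder (L i)) f).
Proof.
move=> iJ; move am: (mdeg a) => m; set r := oporder _; set l := lead_coef _.
elim: m a am => [|m IHm] a am sa.
  move/eqP: am; rewrite mdeg_eq0 => /eqP ->; rewrite add0m add0n.
  have := Lf iJ; rewrite -(prednK (ltnW (L_gt1 iJ))) big_ord_recr /=.
  rewrite -lead_coefE addrC => /eqP; rewrite addr_eq0 => /eqP ->.
  apply/spanN/span_sum => k _; apply: span1; last exact: L_deg.
  split; first exact: supportedU.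
  by rewrite mdegMn mdeg1 mul1n.
have [j aj] : exists j, a j != 0%N.
  apply/existsP; rewrite -negb_forall; apply/negP => /forallP a0.
  have : a = 0%MM by apply/mnmP => j; rewrite mnm0E; apply/eqP/a0.
  by move=> aE; rewrite aE mdeg0 in am.
have jJ : j \in J by apply: contraNT aj => /sa ->.
pose a' := (a - U_(j))%MM.
have aE : a = (a' + U_(j))%MM by rewrite submK // lep1mP.
have am' : mdeg a' = m.
  by move: am; rewrite {1}aE mdegD mdeg1 addn1 => -[].
have sa' : supported a' by apply: supportedB.
pose b := (a' + U_(i) *+ r)%MM.
have -> : (a + U_(i) *+ r = b + U_(j))%MM by rewrite /b {1}aE -!addmA [(U_(j) + _)%MM]addmC.
have -> : l *: dser (b + U_(j)) f =
    dser U_(j) (l *: dser b f) - l^`M(j) *: dser b f.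
  by rewrite dserUZ -dserDm addrC addKr.
have sb : supported b by apply: supportedD => //; apply: supportedU.
have mb : mdeg b = (m + r)%N by rewrite mdegD am' mdegMn mdeg1 mul1n.
apply: spanD; last first.
  apply/spanN/span1; first by split; rewrite // mb addSn.
  exact/degle_deriv/L_deg.
apply: span_dser (IHm a' am' sa') => c [sc mc]; rewrite addSn.
split; split; rewrite ?mdegD ?mdeg1 ?addn1 ?ltnS //; first exact: ltnW.
exact/supportedD/supportedU1.
Qed.

Definition reduced a := supported a /\ forall i, i \in J -> (a i < oporder (L i))%N.

Let D := (\sum_(i in J) d i)%N.
Definition lead_prod := \prod_(i in J) lead_coef (L i).

Lemma lead_prod_neq0 : lead_prod != 0.
Proof.
apply/prodf_neq0 => i iJ; rewrite lead_coef_eq0 -size_poly_gt0.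
exact/ltnW/L_gt1.
Qed.

(** Each use of [span_lead_coef] lowers the total order and spends one factor [lead_prod]: its part
    [lead_coef (L i)] permits the rewriting, the other leading coefficients only add to the degree.
    Each round costs degree [D]. *)
Lemma span_reduced m a : supported a -> (mdeg a <= m)%N ->
  dspan reduced (m * D) (lead_prod ^+ m *: dser a f).
Proof.
have dL : degle D lead_prod by apply: (degle_prod (e := d)) => // i iJ; apply: L_deg.
elim: m a => [|m IHm] a sa am; have [ra|] :=
  boolP [forall i in J, a i < oporder (L i)]%N.
1,3: by apply: span1 (degleXn _ dL); split=> // i; apply/implyP; move/forallP: ra.
all: rewrite negb_forall => /existsP[i]; rewrite negb_imply -leqNgt => /andP[iJ rai].
  (* For [m = 0] the index is zero, hence reduced because the orders are positive. *)
  have := L_gt1 iJ; have : (a i <= mdeg a)%N.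
    by rewrite mdegE (bigD1 i) //= leq_addr.
  by move: rai am; rewrite /oporder; lia.
pose b := (a - U_(i) *+ oporder (L i))%MM.
have aE : a = (b + U_(i) *+ oporder (L i))%MM.
  rewrite submK //; apply/mnm_lepP => j; rewrite mulmnE mnm1E.
  by case: eqP => [<-|_] //; rewrite mul1n.
have -> : lead_prod ^+ m.+1 = (\prod_(j in J | j != i) lead_coef (L j)) *
    (lead_prod ^+ m * lead_coef (L i)).
  rewrite exprSr mulrCA; congr (_ * _).
  by rewrite /lead_prod (bigD1 i) //= mulrC.
rewrite -!scalerA.
have -> : (m.+1 * D = (d i + m * D) + \sum_(j in J | j != i) d j)%N.
  by rewrite mulSn {1}/D (bigD1 i) //= -!addnA; congr addn; rewrite addnC.
apply: span_scale.
  by apply: (degle_prod (e := d)) => // j /andP[jJ _]; apply: L_deg.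
have sb : supported b by apply: supportedB.
rewrite aE; apply: span_trans (span_lead_coef iJ sb) => c [sc].
have -> : (mdeg b + oporder (L i) = mdeg a)%N.
  by rewrite [in RHS]aE mdegD mdegMn mdeg1 mul1n.
by move=> ca; apply: IHm => //; rewrite -ltnS (leq_trans ca).
Qed.

(** * The Euler operator and its shifted products *)

Section Euler.
Variables (i0 i1 : 'I_n).

Definition euler g := 'X_i0 *: dser U_(i0) g - 'X_i1 *: dser U_(i1) g.

(** Reading [euler] as [s D_s], this is [s^(c + k + 1) D_s^k (s^(-c - 1) g)]: derivatives of a
    series with a pole, kept free of negative powers. *)
Fixpoint eulers c k g :=
  if k is k'.+1 then euler (eulers c k' g) - (c + k)%:R%:MP *: eulers c k' g
  else g.

(** Monomials are eigenvectors; the eigenvalue [m i0 - m i1] is the exponent of [s] after the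
    substitution. *)
Lemma eulerE g m : euler g m = ((m i0)%:R - (m i1)%:R) * g m.
Proof.
have XdE i : ('X_i *: dser U_(i) g) m = (m i)%:R * g m.
  rewrite mser_scaleXE lep1mP; case: eqP => [->|/eqP mi]; first by rewrite mul0r.
  rewrite dserU_sderiv /sderiv.
  have mE : mshift (m - U_(i)) i = m.
    apply/mnmP => j; rewrite mnmE mnmBE mnm1E -val_eqE /= eq_sym.
    by case: eqP => [/val_inj ij|]; rewrite ?addn0 ?subn0 // -?ij subnK // lt0n ij.
  rewrite mE; congr (_%:R * _); rewrite /mexp (eq_bigl (pred1 i)) ?big_pred1_eq //.
  by rewrite mnmBE mnm1E eqxx subn1 prednK // lt0n.
by rewrite /euler mserDE mserNE !XdE mulrBl.
Qed.

Lemma eulersE c k g m : eulers c k g m =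
  (\prod_(l < k) ((m i0)%:R - (m i1)%:R - (c + l.+1)%:R)) * g m.
Proof.
elim: k => [|k IHk] /=; first by rewrite big_ord0 mul1r.
rewrite mserDE mserNE eulerE mser_scaleCE -mulrBl IHk big_ord_recr /=.
by rewrite mulrCA mulrA.
Qed.

Hypotheses (i0J : i0 \in J) (i1J : i1 \in J).

(** Each factor differentiates once and multiplies by a variable, so order and degree both grow by
    at most one. *)
Lemma span_eulers c k m g : dspan (low m) 0 g -> dspan (low (k + m)) k (eulers c k g).
Proof.
move=> gm; elim: k => [//|k IHk] /=; rewrite addSn.
have low_dser i : i \in J ->
    dspan (low (k + m).+1) k.+1 ('X_i *: dser U_(i) (eulers c k g)).
  move=> iJ; have dX : degle 1 ('X_i : {mpoly K[n]}) by rewrite -(mdeg1 i) degleX.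
  rewrite -[X in dspan _ X _]addn1; apply: span_scale dX _.
  apply: span_dser IHk => a [sa am]; split; split=> //.
  - exact: ltnW.
  - exact/supportedD/supportedU1.
  - by rewrite mdegD mdeg1 addn1.
apply: spanD; first by apply: spanD; [|apply: spanN]; apply: low_dser.
apply: spanN; rewrite -[k.+1]addn0; apply: span_scale; first exact: degleC.
by apply: span_sub IHk => // a [sa am]; split=> //; apply: ltnW.
Qed.

End Euler.
End Reduction.
End Span.

(** * The substitution x_1 = s, x_2 = t / s *)

Section DiagonalSubstitution.
Variables (K : fieldType) (N : nat).
Implicit Types (u v : 'X_{1..N.+1}) (m : 'X_{1..N.+2}) (p : {mpoly K[N.+1]}).
Implicit Types (g : mser K N.+2).

Local Notation x1 := (ord0 : 'I_N.+2).
Local Notation x2 := (lift ord0 ord0 : 'I_N.+2).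

(** Index 0 of [u] belongs to [t]; its exponent goes to both [x_1] and [x_2] because
    [t = x_1 x_2]. *)
Definition diag_mnm u : 'X_{1..N.+2} :=
  [multinom (if unlift ord0 i is Some j then u j else u ord0) | i < N.+2].

Lemma diag_mnm0E u : diag_mnm u ord0 = u ord0.
Proof. by rewrite mnmE unlift_none. Qed.

Lemma diag_mnmSE u j : diag_mnm u (lift ord0 j) = u j.
Proof. by rewrite mnmE liftK. Qed.

Lemma mexpE n (a : 'X_{1..n}) (i : 'I_n) : mexp a i = a i.
Proof. by rewrite /mexp (eq_bigl (pred1 i)) ?big_pred1_eq. Qed.

Lemma diag21E g u : diag21 g u = g (diag_mnm u).
Proof.
congr (g _); apply/mnmP => i; rewrite !mnmE.
case: unliftP => [j ->|->] /=; first by rewrite mexpE.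
by rewrite (mexpE u ord0).
Qed.

Lemma diag_mnmD u v : diag_mnm (u + v) = (diag_mnm u + diag_mnm v)%MM.
Proof.
apply/mnmP => i; rewrite mnmDE; case: (unliftP ord0 i) => [j|] ->.
  by rewrite !diag_mnmSE mnmDE.
by rewrite !diag_mnm0E mnmDE.
Qed.

Lemma diag_mnm0 : diag_mnm 0 = 0%MM.
Proof. by apply/mnmP => i; rewrite mnm0E mnmE; case: unlift => [j|]; rewrite mnm0E. Qed.

Lemma diag_mnmUMn j k :
  diag_mnm (U_(j) *+ k) = (U_(lift ord0 j) *+ k + U_(x1) *+ ((j == ord0) * k))%MM.
Proof.
apply/mnmP => i; rewrite mnmDE !mulmnE !mnm1E.
case: (unliftP ord0 i) => [l|] ->.
  by rewrite diag_mnmSE mulmnE mnm1E (inj_eq lift_inj) mul0n addn0.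
by rewrite diag_mnm0E mulmnE mnm1E eqxx mul1n.
Qed.

(** Embeds the polynomials in [t, x_3, ...], those free of [s], into the original variables by
    [t = x_1 x_2]. *)
Definition diag_sub : {mpoly K[N.+1]} -> {mpoly K[N.+2]} :=
  mmap (@mpolyC N.+2 K) (fun j => 'X_[diag_mnm U_(j)]).

HB.instance Definition _ := GRing.RMorphism.on diag_sub.

Lemma diag_subX u : diag_sub 'X_[u] = 'X_[diag_mnm u].
Proof.
rewrite /diag_sub mmapX /mmap1.
rewrite [u in RHS]multinomUE_id (big_morph _ diag_mnmD diag_mnm0).
rewrite (big_morph _ (@mpolyXD _ K) (@mpolyX0 _ K)); apply: eq_bigr => j _.
rewrite mpolyXn; congr 'X_[_]; apply/mnmP => i.
rewrite mulmnE; case: (unliftP ord0 i) => [l|] ->.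
  by rewrite !diag_mnmSE mulmnE.
by rewrite !diag_mnm0E mulmnE.
Qed.

Lemma diag_subE p : diag_sub p = \sum_(u <- msupp p) p@_u *: 'X_[diag_mnm u].
Proof.
rewrite {1}[p]mpolyE raddf_sum; apply: eq_bigr => u _ /=.
by rewrite -!mul_mpolyC rmorphM /= diag_subX; congr (_ * _); apply: mmapC.
Qed.

(* The coefficients of [s^d] after the substitution [x_1 = s, x_2 = t / s]. *)
Definition sub_diag (d : nat) g : mser K N.+1 :=
  fun u => g (diag_mnm u + U_(x1) *+ d)%MM.

Lemma sub_diagD d : {morph sub_diag d : g h / g + h}.
Proof. by []. Qed.

Lemma sub_diag0 d : sub_diag d 0 = 0.
Proof. by []. Qed.

Lemma diag_mnm_le u v d :
  (diag_mnm u <= diag_mnm v + U_(x1) *+ d)%MM = (u <= v)%MM.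
Proof.
apply/mnm_lepP/mnm_lepP => uv i.
  have := uv (lift ord0 i); rewrite mnmDE mulmnE mnm1E !diag_mnmSE.
  by rewrite mul0n addn0.
rewrite mnmDE; case: (unliftP ord0 i) => [j|] ->.
  by rewrite !diag_mnmSE (leq_trans (uv j)) ?leq_addr.
by rewrite !diag_mnm0E (leq_trans (uv _)) ?leq_addr.
Qed.

(** The monomials of [diag_sub p] have exponent 0 in [s], so extracting the coefficient of [s^d] is
    linear over them. *)
Lemma sub_diagZ d p g : sub_diag d (diag_sub p *: g) = p *: sub_diag d g.
Proof.
apply: boolp.funext => u; rewrite /sub_diag diag_subE scaler_suml mser_sumE.
rewrite mser_scaleE; apply: eq_bigr => v _.
rewrite -mul_mpolyC -scalerA mser_scaleCE mser_scaleXE diag_mnm_le.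
case: ifP => vu; last by rewrite mulr0.
congr (_ * g _); rewrite -[in LHS](submK vu) diag_mnmD.
by apply/mnmP => i; rewrite !(mnmDE, mnmBE) addnAC addnK.
Qed.

Lemma sub_diagXn d e g :
  (e <= d)%N -> sub_diag d ('X_[U_(x1) *+ e] *: g) = sub_diag (d - e) g.
Proof.
move=> ed; apply: boolp.funext => u; rewrite /sub_diag mser_scaleXE.
have -> : (U_(x1) *+ d = U_(x1) *+ (d - e) + U_(x1) *+ e)%MM.
  by apply/mnmP => i; rewrite mnmDE !mulmnE -mulnDr subnK.
by rewrite addmA lem_addl addmK.
Qed.

Lemma dserUMnE n (i : 'I_n) k (h : mser K n) a :
  dser (U_(i) *+ k) h a = ((a i + k) ^_ k)%:R * h (U_(i) *+ k + a)%MM.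
Proof.
rewrite /dser (bigD1 i) //= big1 ?muln1 => [|j ji].
  by rewrite mnmDE mulmnE mnm1E eqxx mul1n addnC.
by rewrite [X in (_ ^_ X)%N]mulmnE mnm1E eq_sym (negPf ji) ffactn0.
Qed.

(** [D_2] lowers the exponent of [x_2] and so raises that of [s]: the [k]-th derivative of the
    diagonal sits at [s^k] for [D_t], and at [s^0] for the other derivations. *)
Lemma sub_diag_dser (j : 'I_N.+1) k g :
  sub_diag ((j == ord0) * k) (dser (U_(lift ord0 j) *+ k) g) =
  dser (U_(j) *+ k) (diag21 g : mser K N.+1).
Proof.
apply: boolp.funext => u; rewrite /sub_diag !dserUMnE diag21E.
rewrite diag_mnmD diag_mnmUMn -!addmA [(_ + diag_mnm u)%MM]addmC.
by rewrite mnmDE mulmnE mnm1E diag_mnmSE mul0n addn0.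
Qed.

Lemma sub_diag_eulers d c k g :
  sub_diag d (eulers x1 x2 c k g) =
  (\prod_(l < k) (d%:R - (c + l.+1)%:R))%:MP *: sub_diag d g.
Proof.
apply: boolp.funext => u; rewrite mser_scaleCE /sub_diag eulersE.
congr (_ * _); apply: eq_bigr => l _; congr (_ - _).
rewrite !mnmDE !mulmnE !mnm1E diag_mnm0E diag_mnmSE eqxx mul0n mul1n addn0.
by rewrite natrD addrAC subrr add0r.
Qed.

(** A monomial with [m x2 <= m x1] is [s^(m x1 - m x2)] times a monomial in [t, x_3, ...] of degree
    [mdeg m - m x1]. The terms are grouped by the power of [s]. *)
Lemma diag_sub_decomp s b (C : {mpoly K[N.+2]}) :
    (forall m, C@_m != 0 -> [/\ m x2 <= m x1, m x1 <= m x2 + s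
                              & mdeg m <= m x1 + b]%N) ->
  exists c : 'I_s.+1 -> {mpoly K[N.+1]}, (forall i, degle b (c i)) /\
    C = \sum_(i < s.+1) 'X_[U_(x1) *+ i] * diag_sub (c i).
Proof.
move=> sC; pose r m : 'X_{1..N.+1} := [multinom m (lift ord0 j) | j < N.+1].
have rK m i : m x1 = (m x2 + i)%N -> m = (U_(x1) *+ i + diag_mnm (r m))%MM.
  move=> mi; apply/mnmP => l; rewrite mnmDE mulmnE mnm1E.
  case: (unliftP ord0 l) => [l'|] ->.
    by rewrite diag_mnmSE mnmE mul0n.
  by rewrite diag_mnm0E mnmE eqxx mul1n addnC.
pose F i m := (m x1 == m x2 + i)%N.
exists (fun i : 'I_s.+1 => \sum_(m <- msupp C | F i m) C@_m *: 'X_[r m]).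
split=> [i|].
  rewrite big_seq_cond; apply: degle_sum => m /andP[mC _].
  rewrite -mul_mpolyC -[b]add0n; apply: degleM; first exact: degleC.
  apply: degle_leq (degleX _ _); rewrite mcoeff_msupp in mC.
  have [_ _] := sC m mC; rewrite !mdegE big_ord_recl leq_add2l.
  by congr (_ <= _)%N; apply: eq_bigr => j _; rewrite mnmE.
under eq_bigr => i _.
  rewrite raddf_sum mulr_sumr /=.
  under eq_bigr => m Fim.
    rewrite -mul_mpolyC rmorphM /= diag_subX {1}/diag_sub mmapC mulrCA.
    rewrite -mpolyXD -(rK m i (eqP Fim)).
  over.
over.
rewrite {1}[C]mpolyE (exchange_big_dep predT) //= !big_seq.
apply: eq_bigr => m; rewrite mcoeff_msupp => /sC[m12 m1s _].
have ms : (m x1 - m x2 < s.+1)%N by rewrite ltnS leq_subLR.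
rewrite (eq_bigl (pred1 (Ordinal ms))) ?big_pred1_eq ?mul_mpolyC // => i.
by rewrite /F /= -val_eqE /= -{1}(subnKC m12) eqn_add2l eq_sym.
Qed.

End DiagonalSubstitution.

(** * Relations between the derivatives and their residues *)

Lemma card_triangle M :
  (#|{: {x : 'I_M.+1 * 'I_M.+1 | x.1 + x.2 <= M}}| * 2 = M.+1 * M.+2)%N.
Proof.
rewrite card_sig -sum1_card -(pair_big_dep predT (fun i j : 'I_M.+1 => i + j <= M)%N
  (fun _ _ => 1%N)) /=.
rewrite (eq_bigr (fun i : 'I_M.+1 => M.+1 - i)%N) => [|i _]; last first.
  rewrite -[RHS]card_ord -sum1_card (big_ord_widen M.+1 (fun=> 1%N)) ?leq_subr //.
  by apply: eq_bigl => j; rewrite ltn_subRL ltnS.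
elim: M => [|M IHM]; first by rewrite big_ord_recl big_ord0.
rewrite big_ord_recl subn0 mulnDl.
under eq_bigr => i _ do rewrite lift0 subSS.
by rewrite IHM; lia.
Qed.

Lemma ltn_ord_card r b : (#|[pred z : 'I_b | z < r]| <= r)%N.
Proof.
rewrite -sum1_card -[X in (_ <= X)%N]card_ord -sum1_card.
have [rb|br] := leqP r b; first by rewrite (big_ord_widen b (fun=> 1%N)).
rewrite !sum1_card card_ord; apply: leq_trans (max_card _) _.
by rewrite card_ord ltnW.
Qed.

Section Assembly.
Variables (K : fieldType).

(** Reduced indices vanish outside [J] and lie below the orders inside it, so they are encoded in a
    [pfamily], whose cardinal is a product. *)
Lemma reduced_finite n (J : {set 'I_n}) (L : 'I_n -> op K n) :
  exists (I : finType) (e : I -> 'X_{1..n}),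
    (#|I| <= \prod_(i in J) oporder (L i))%N /\
    forall a, reduced J L a -> exists i, e i = a.
Proof.
pose b := (\sum_i oporder (L i))%N.
pose F i := [pred z : 'I_b.+1 | z < oporder (L i)]%N.
exists {: {h : {ffun 'I_n -> 'I_b.+1} | h \in pfamily ord0 (mem J) F}}.
exists (fun h => [multinom ((val h : {ffun 'I_n -> 'I_b.+1}) i : nat) | i < n]); split.
  rewrite card_sig (eq_card (B := pfamily ord0 (mem J) F)) // card_pfamily.
  rewrite foldrE big_image /=; apply: leq_prod => i _; exact: ltn_ord_card.
move=> a [sa ra]; pose h := [ffun i => inord (a i) : 'I_b.+1].
have hE i : h i = a i :> nat.
  rewrite ffunE inordK // ltnS; have [iJ|iJ] := boolP (i \in J); last by rewrite sa.
  by apply: leq_trans (ltnW (ra i iJ)) _; rewrite /b (bigD1 i) //= leq_addr.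
have hP : h \in pfamily ord0 (mem J) F.
  apply/pfamilyP; split=> [|i iJ]; last by rewrite inE hE ra.
  apply/subsetP => i; rewrite !inE; apply: contraNT => iJ.
  by rewrite -val_eqE /= hE sa.
by exists (exist _ h hP); apply/mnmP => i; rewrite mnmE hE.
Qed.

Section Diagonal.
Variable N : nat.
Local Notation x1 := (ord0 : 'I_N.+2).
Local Notation x2 := (lift ord0 ord0 : 'I_N.+2).
Variables (f : mser K N.+2) (j0 : 'I_N.+1).
Local Notation w := (nat_of_bool (j0 == ord0)).
Local Notation xj := (lift ord0 j0 : 'I_N.+2).

(* Up to a power of [s = x_1], this is [D_s^i D_{x_j}^k (F / s)] for
   [F = f(s, t / s, x_3, ...)], written in the original variables: [t = x_1 x_2]
   gives [s D_s = x_1 D_1 - x_2 D_2] and [s D_t = D_2]. *)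
Definition residue_deriv i k : mser K N.+2 :=
  eulers x1 x2 (w * k) i (dser (U_(xj) *+ k) f).

(* Taking the residue of the relation at [D_s^i] with [i] minimal kills all
   terms divisible by [D_s^(i+1)]. *)
Lemma residue_relation M s (p : 'I_M.+1 -> 'I_M.+1 -> {mpoly K[N.+1]}) :
    [pchar K] =i pred0 ->
    (forall i k, p i k != 0 -> (i + w * k <= s)%N) ->
    (exists i k, p i k != 0) ->
    \sum_i \sum_k diag_sub (p i k) *:
      ('X_[U_(x1) *+ (s - i - w * k)] *: residue_deriv i k) = 0 ->
  exists i, (exists k, p i k != 0) /\
    \sum_k p i k *: dser (U_(j0) *+ k) (diag21 f : mser K N.+1) = 0.
Proof.
move=> char0 ps [a0 [b0 pab0]] rel.
pose nz (i : 'I_M.+1) := [exists k, p i k != 0].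
have nza : nz a0 by apply/existsP; exists b0.
have [i /existsP nzi imin] := arg_minnP (fun i : 'I_M.+1 => i : nat) nza.
exists i; split=> //.
(* The value of the Euler factors at the minimal [i] is [(-1)^i i!], nonzero in characteristic 0. *)
pose c : K := \prod_(l < i) - (l.+1)%:R.
have c0 : c%:MP_[N.+1] != 0.
  rewrite mpolyC_eq0; apply/prodf_neq0 => l _; rewrite oppr_eq0.
  by have /pcharf0P -> := char0.
(* Before denominators are cleared, this index is the power [-i - 1] of [x_1], to which [D_s^i]
   carries the residue. *)
apply: mser_scale_eq0 c0 _; have := congr1 (sub_diag (s - i)) rel.
rewrite (big_morph _ (@sub_diagD _ _ _) (@sub_diag0 _ _ _)) sub_diag0 => rel0.
rewrite -[RHS]rel0 [RHS](bigD1 i) //= [X in _ = _ + X]big1 => [|a ai].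
  rewrite addr0 (big_morph _ (@sub_diagD _ _ _) (@sub_diag0 _ _ _)) scaler_sumr.
  apply: eq_bigr => k _; rewrite sub_diagZ.
  have [->|pik] := eqVneq (p i k) 0; first by rewrite !scale0r scaler0.
  have is_ := ps i k pik.
  rewrite sub_diagXn ?leq_subr // subKn; last by rewrite leq_subRL // (leq_trans _ is_) ?leq_addr.
  rewrite sub_diag_eulers sub_diag_dser scalerA mulrC -scalerA.
  congr (_ *: (_%:MP *: _)); apply: eq_bigr => l _.
  by rewrite natrD opprD addrA subrr add0r.
rewrite (big_morph _ (@sub_diagD _ _ _) (@sub_diag0 _ _ _)) big1 // => k _.
rewrite sub_diagZ.
have [->|pak] := eqVneq (p a k) 0; first by rewrite scale0r.
have ia : (i < a)%N.
  by rewrite ltn_neqAle eq_sym val_eqE ai imin //; apply/existsP; exists k.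
have as_ := ps a k pak.
rewrite sub_diagXn; last by move: ia as_; lia.
have -> : (s - i - (s - a - w * k) = w * k + (a - i))%N by move: ia as_; lia.
(* The factor with index [a - i - 1] vanishes: a derivative of order [a] in [s] has no terms of
   degrees [-a] to [-1]. *)
have ai_a : ((a - i).-1 < a)%N by move: ia; lia.
rewrite sub_diag_eulers (bigD1 (Ordinal ai_a)) //= prednK ?subn_gt0 //.
by rewrite subrr mul0r mpolyC0 scale0r scaler0.
Qed.

Section Existence.
Variables (J : {set 'I_N.+2}) (L : 'I_N.+2 -> op K N.+2) (d : 'I_N.+2 -> nat).
Hypothesis L_gt1 : forall i, i \in J -> (1 < size (L i))%N.
Hypothesis L_deg : forall i k, i \in J -> degle (d i) (L i)`_k.
Hypothesis Lf : forall i, i \in J ->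
  \sum_(k < size (L i)) (L i)`_k *: dser (U_(i) *+ k) f = 0.
Hypotheses (x1J : x1 \in J) (x2J : x2 \in J) (xjJ : xj \in J).

Let D := (\sum_(i in J) d i)%N.
Let R := (\prod_(i in J) oporder (L i))%N.

(** The Euler factors contribute degree [i]; the total order is at most [i + k <= M], so [M] rounds
    of reduction suffice, at degree [D] each. *)
Lemma span_residue_deriv M i k : (i + k <= M)%N ->
  dspan f (reduced J L) (i + M * D) (lead_prod J L ^+ M *: residue_deriv i k).
Proof.
move=> ikM; have low_dser : dspan f (low J k.+1) 0 (dser (U_(xj) *+ k) f).
  rewrite -[dser _ _]scale1r; apply: span1; last by rewrite -mpolyC1 degleC.
  by split; [exact: supportedU | rewrite mdegMn mdeg1 mul1n].
have := span_eulers x1J x2J (w * k) i low_dser.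
apply: span_trans => a [sa am]; apply: span_reduced => //.
by rewrite -ltnS (leq_trans am) // addnS ltnS.
Qed.

(** The unknowns are the [p i k] with [i + k <= M]. There is one equation for each of at most [R]
    reduced derivatives and each power of [s] from 0 to [2 (D + 1) M]; the hypothesis says that
    unknowns outnumber equations. *)
Lemma residue_syzygy M : (R * (2 * D.+1 * M).+1 * 2 < M.+1 * M.+2)%N ->
  exists p : 'I_M.+1 -> 'I_M.+1 -> {mpoly K[N.+1]},
    [/\ forall i k, p i k != 0 -> (i + k <= M)%N,
        exists i k, p i k != 0,
        forall i k, degle (R * (2 * D.+1 * M).+1 * (D.+1 * M)) (p i k) &
        \sum_i \sum_k diag_sub (p i k) *:
          ('X_[U_(x1) *+ (2 * M - i - w * k)] *: residue_deriv i k) = 0].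
Proof.
move=> RM; pose T := {: {x : 'I_M.+1 * 'I_M.+1 | x.1 + x.2 <= M}}%N.
have [I [e [cardI eP]]] := reduced_finite J L.
pose s := (2 * D.+1 * M)%N.
pose lam := lead_prod J L ^+ M.
(* The inequality [2 M - i - w k >= i] offsets the degree [i] of the Euler factors, and a further
   factor [x_1^(D M)] offsets that of the reduction, so that [m x2 <= m x1] for every monomial. *)
pose mon (x : T) := (2 * M - (sval x).1 - w * (sval x).2)%N.
have decomp (x : T) : exists c : I -> 'I_s.+1 -> {mpoly K[N.+1]},
    (forall b i, degle (D.+1 * M) (c b i)) /\
    ('X_[U_(x1) *+ (D * M)] * lam) *:
      ('X_[U_(x1) *+ mon x] *: residue_deriv (sval x).1 (sval x).2) =
    \sum_b (\sum_(i < s.+1) 'X_[U_(x1) *+ i] * diag_sub (c b i)) *: dser (e b) f.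
  case: x => -[i k] /= ikM; rewrite /mon /=.
  have [C [dC CE]] := span_finite eP (span_residue_deriv ikM).
  have shifted b : exists c : 'I_s.+1 -> {mpoly K[N.+1]},
      (forall u, degle (D.+1 * M) (c u)) /\
      'X_[U_(x1) *+ (D * M + (2 * M - i - w * k))] * C b =
        \sum_(u < s.+1) 'X_[U_(x1) *+ u] * diag_sub (c u).
    apply: diag_sub_decomp => m; rewrite mcoeffXM; case: ifP => [le_m Cm|_]; last by rewrite eqxx.
    have /degleP/(_ _ Cm) := dC b.
    have lek : (w * k <= k)%N by case: (j0 == ord0); rewrite ?mul1n ?mul0n.
    have mE l : (m l = (m - U_(x1) *+ (D * M + (2 * M - i - w * k)))%MM l +
        (x1 == l) * (D * M + (2 * M - i - w * k)))%N.
      rewrite mnmBE mulmnE mnm1E subnK //.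
      by move/mnm_lepP/(_ l): le_m; rewrite mulmnE mnm1E.
    move: mE; set m' := (m - _)%MM => mE.
    have -> : mdeg m = (mdeg m' + (D * M + (2 * M - i - w * k)))%N.
      rewrite !mdegE (eq_bigr _ (fun l _ => mE l)) big_split /=; congr addn.
      rewrite (bigD1 x1) //= mul1n big1 ?addn0 // => l /negPf.
      by rewrite eq_sym => ->.
    rewrite (mE x1) (mE x2) eqxx mul1n mul0n addn0.
    have : (m' x1 + m' x2 <= mdeg m')%N.
      by rewrite mdegE !big_ord_recl /= addnA leq_addr.
    rewrite /s; move: ikM lek; generalize (w * k)%N => wk.
    have -> : (2 * D.+1 * M = 2 * (M * D) + 2 * M)%N by lia.
    have -> : (D.+1 * M = M * D + M)%N by lia.
    have -> : (D * M = M * D)%N by lia.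
    generalize (M * D)%N (mdeg m') (m' x1) (m' x2) => MD dm a1 a2.
    by split; lia.
  have [c cP] := boolp.choice shifted.
  exists c; split=> [b u|]; first by have [/(_ u)] := cP b.
  rewrite scalerA mulrAC -mpolyXD -scalerA.
  have -> e1 e2 : (U_(x1) *+ e1 + U_(x1) *+ e2 = U_(x1) *+ (e1 + e2) :> 'X_{1..N.+2})%MM.
    by apply/mnmP => l; rewrite mnmDE !mulmnE mulnDr.
  rewrite CE scaler_sumr; apply: eq_bigr => b _.
  by rewrite scalerA; have [_ ->] := cP b.
have [c cP] := boolp.choice decomp.
pose A (bu : I * 'I_s.+1) (x : T) := c x bu.1 bu.2.
have cardA : (#|{: I * 'I_s.+1}| <= R * s.+1)%N.
  by rewrite card_prod card_ord leq_mul2r cardI orbT.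
have ltIT : (#|{: I * 'I_s.+1}| < #|{: T}|)%N.
  have := card_triangle M; rewrite -/T; move: cardA RM; rewrite -/s; lia.
have [v [[x0 vx0] dv vA]] := small_syzygy ltIT (fun bu x => (cP x).1 bu.1 bu.2).
pose p i k := if insub (i, k) is Some x then v x else 0.
have pT (x : T) : p (sval x).1 (sval x).2 = v x.
  by rewrite /p -surjective_pairing valK.
exists p; split.
- by move=> i k; rewrite /p; case: insubP => [x /= ->|_] //; rewrite eqxx.
- by exists (sval x0).1, (sval x0).2; rewrite pT.
- move=> i k; rewrite /p; case: insubP => [x _ _|_]; last exact: degle0.
  by apply: degle_leq (dv x); rewrite leq_mul2r cardA orbT.
have lam0 : 'X_[U_(x1) *+ (D * M)] * lam != 0.
  rewrite mulf_neq0 // ?expf_neq0 ?(lead_prod_neq0 L_gt1) //.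
  by rewrite -msize_poly_eq0 msizeX.
apply: mser_scale_eq0 lam0 _.
transitivity (\sum_(x : T) diag_sub (v x) *: (('X_[U_(x1) *+ (D * M)] * lam) *:
    ('X_[U_(x1) *+ mon x] *: residue_deriv (sval x).1 (sval x).2))).
  rewrite pair_big /= scaler_sumr (bigID (fun x : 'I_M.+1 * 'I_M.+1 => x.1 + x.2 <= M)%N) /=.
  rewrite [X in _ + X]big1 ?addr0 => [|[i k] /= ikM]; last first.
    by rewrite /p insubN // rmorph0 scale0r scaler0.
  rewrite (reindex_omap (sval : T -> _) insub) /=; last first.
    by move=> x xM; rewrite insubT.
  apply: eq_big => [x|x _]; first by rewrite (valP x) valK eqxx.
  by rewrite pT !scalerA [diag_sub _ * _]mulrC.
under eq_bigr => x _ do rewrite (cP x).2 scaler_sumr.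
(* The coefficient at each derivative [e b] and each power of [x_1] is one of the equations solved
   by [v]. *)
rewrite exchange_big big1 //= => b _.
under eq_bigr => x _ do rewrite scalerA mulr_sumr.
rewrite -scaler_suml exchange_big big1 ?scale0r //= => u _.
under eq_bigr => x _ do rewrite mulrCA -rmorphM.
rewrite -mulr_sumr -raddf_sum.
under eq_bigr => x _ do rewrite mulrC.
by rewrite (vA (b, u)) raddf0 mulr0.
Qed.

End Existence.
End Diagonal.
End Assembly.

(** * Operators annihilating the diagonal and explicit bounds *)

Lemma opdegP (K : fieldType) n (P : op K n) b :
  reflect (forall k, degle b P`_k) (opdeg P <= b)%N.
Proof.
apply: (iffP idP) => [Pb k|Pb].
  have [kP|Pk] := ltnP k (size P); last by rewrite nth_default // degle0.
  rewrite /degle -[(_ <= b.+1)%N]/(_ <= 1 + b)%N -leq_subLR subn1.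
  by apply: leq_trans Pb; apply: (leq_bigmax (Ordinal kP)).
apply/bigmax_leqP => k _; have := Pb k; rewrite /degle.
by rewrite -[(_ <= b.+1)%N]/(_ <= 1 + b)%N -leq_subLR subn1.
Qed.

Lemma opapply_widen (K : fieldType) n (P : op K n) (i : 'I_n) (g : mser K n) s :
  (size P <= s)%N ->
  opapply P i g = \sum_(k < s) P`_k *: dser (U_(i) *+ k) g :> mser K n.
Proof.
move=> Ps; rewrite opapplyE (big_ord_widen s (fun k => P`_k *: dser (U_(i) *+ k) g)) //.
rewrite [RHS](bigID (fun k : 'I_s => k < size P)%N) /=.
rewrite [X in _ = _ + X]big1 ?addr0 // => k; rewrite -leqNgt => Pk.
by rewrite nth_default // scale0r.
Qed.

(** Treats [D_t] and [D_(x_h)] together: for [j0 = ord0] the set [J] collapses to the indices of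
    [x_1] and [x_2]. *)
Lemma diag_annihilator (K : fieldType) N (f : series K N.+2) (j0 : 'I_N.+1)
    (L : 'I_N.+2 -> op K N.+2)
    (J := [set ord0; lift ord0 ord0; lift ord0 j0])
    (D := (\sum_(i in J) opdeg (L i))%N)
    (R := (\prod_(i in J) oporder (L i))%N)
    (M := (4 * D.+1 * R)%N) :
  [pchar K] =i pred0 ->
  (forall i, i \in J -> L i != 0 /\ opapply (L i) i f = @zerops K N.+2) ->
  exists P : op K N.+1,
    [/\ P != 0, opapply P j0 (diag21 f) = @zerops K N.+1,
        (opdeg P <= R * (2 * D.+1 * M).+1 * (D.+1 * M))%N
      & (oporder P <= M)%N].
Proof.
move=> char0 Lf.
(* If some [L i] has order 0, it is a nonzero polynomial, so [f = 0] by torsion-freeness. Then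
   [R = M = 0], and the operator 1 meets the bounds. *)
have [/forallP L_gt1|] := boolP [forall i, (i \in J) ==> (1 < size (L i))%N]; last first.
  rewrite negb_forall => /existsP[i]; rewrite negb_imply -leqNgt => /andP[iJ Li1].
  have [Li0 Lif] := Lf i iJ.
  have f0 : f = (0 : mser K N.+2).
    have c0 : (L i)`_0 != 0.
      by apply: contraNneq Li0 => c0; rewrite (size1_polyC Li1) c0 polyC0.
    apply: mser_scale_eq0 c0 _; rewrite -[RHS]Lif (opapply_widen _ _ Li1).
    by rewrite big_ord1 mulm0n dser0m.
  exists 1; split; first exact: oner_neq0.
  - rewrite (@opapply_widen _ _ _ _ _ 1) ?size_poly1 // big_ord1 mulm0n dser0m.
    by rewrite f0 coef1 scale1r.
  - apply/opdegP => k; rewrite coef1; case: (k == 0)%N; last exact: degle0.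
    by rewrite -mpolyC1 degleC.
  - by rewrite /oporder size_poly1.
have J1 : ord0 \in J by rewrite !inE eqxx.
have J2 : lift ord0 ord0 \in J by rewrite !inE eqxx orbT.
have Jj : lift ord0 j0 \in J by rewrite !inE eqxx orbT.
have L_gt1J i : i \in J -> (1 < size (L i))%N by move=> iJ; apply: (implyP (L_gt1 i)).
have L_deg i k : i \in J -> degle (opdeg (L i)) (L i)`_k by move=> _; move: k; apply/opdegP.
have LfJ i : i \in J ->
    \sum_(k < size (L i)) (L i)`_k *: dser (U_(i) *+ k) (f : mser K N.+2) = 0.
  by move=> iJ; rewrite -opapplyE; have [] := Lf i iJ.
(* The left side equals [M^2 + 2 R] for this [M], and [M >= 4 R]. *)
have RM : (R * (2 * D.+1 * M).+1 * 2 < M.+1 * M.+2)%N by rewrite /M; nia.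
have [p [pM p_neq0 p_deg rel]] := residue_syzygy L_gt1J L_deg LfJ J1 J2 Jj RM.
have pM2 i k : p i k != 0 -> (i + (j0 == ord0) * k <= 2 * M)%N.
  move=> /pM ik; rewrite mul2n -addnn leq_add //; first exact: leq_trans (leq_addr _ _) ik.
  by case: (j0 == ord0); rewrite ?mul1n //; apply: leq_trans ik; apply: leq_addl.
have [i [[k pik] Pf]] := residue_relation char0 pM2 p_neq0 rel.
pose P : op K N.+1 := \poly_(k < M.+1) p i (inord k).
have Pk (l : 'I_M.+1) : P`_l = p i l by rewrite coef_poly ltn_ord inord_val.
have PM : (size P <= M.+1)%N by apply: size_poly.
exists P; split.
- by apply: contraNneq pik => P0; rewrite -Pk P0 coef0.
- rewrite (opapply_widen _ _ PM) -[RHS]Pf; apply: eq_bigr => l _.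
  by rewrite Pk.
- apply/opdegP => l; rewrite coef_poly; case: ifP => _; first exact: p_deg.
  exact: degle0.
- by rewrite /oporder -subn1 leq_subLR add1n.
Qed.

(* Variables are 0-based: x_1 has index 0, x_2 = t has index 1, x_h has index h-1.
   L i is the operator L_{i+1} in D_{x_{i+1}}. *)
Theorem theorem4p2 (K : fieldType) (n : nat) (f : series K n)
    (L : nat -> op K n) :
  [pchar K] =i pred0 ->
  (2 <= n)%N ->
  Dfinite f ->
  (forall i, (i < n)%N -> L i != 0 /\ opapply (L i) i f = @zerops K n) ->
  let r := fun i => oporder (L i) in
  let d := fun i => opdeg (L i) in
  (exists P : op K n.-1,
     [/\ P != 0, opapply P 0 (diag21 f) = @zerops K n.-1,
         (opdeg P <= 8 * (d 0 + d 1 + 1) ^ 2 * (r 0 * r 1) ^ 2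
                      * (8 * (d 0 + d 1 + 1) ^ 2 * r 0 * r 1 + 1))%N
       & (oporder P <= 4 * (d 0 + d 1 + 1) * r 0 * r 1)%N])
  /\
  (forall h : nat, (2 <= h < n)%N ->
     exists P : op K n.-1,
     [/\ P != 0, opapply P h.-1 (diag21 f) = @zerops K n.-1,
         (opdeg P <= 8 * (d 0 + d 1 + d h + 1) ^ 2 * (r 0 * r 1 * r h) ^ 2
                      * (8 * (d 0 + d 1 + d h + 1) ^ 2 * r 0 * r 1 * r h + 1))%N
       & (oporder P <= 4 * (d 0 + d 1 + d h + 1) * r 0 * r 1 * r h)%N]).
Proof.
move=> char0; case: n f L => [|[|N]] //= f L _ _ Lf.
(* Here [c = D + 1] and [M = 4 c R]; the count yields the leading constant 4, within the stated
   8. *)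
have degree_bound c R : (R * (2 * c * (4 * c * R)).+1 * (c * (4 * c * R)) <=
    8 * c ^ 2 * R ^ 2 * (8 * c ^ 2 * R + 1))%N.
  have -> : (R * (2 * c * (4 * c * R)).+1 * (c * (4 * c * R)) =
      4 * c ^ 2 * R ^ 2 * (8 * c ^ 2 * R + 1))%N by rewrite -addn1; ring.
  by rewrite !leq_mul.
have Lf' (j0 : 'I_N.+1) i : i \in [set ord0; lift ord0 ord0; lift ord0 j0] ->
  L i != 0 /\ opapply (L i) i f = @zerops K N.+2 by move=> _; apply: Lf.
split=> [|[//|h] /andP[h1 hN]].
  have [P] := diag_annihilator (L := fun i => L i) char0 (Lf' ord0).
  rewrite -setUA setUid !big_setU1 ?big_set1 ?inE //= => -[P0 Pf degP ordP].
  exists P; split=> //.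
    by apply: leq_trans degP (leq_trans (degree_bound _ _) _); apply: eq_leq; ring.
  by apply: leq_trans ordP _; apply: eq_leq; ring.
(* The variable has index [h.+1] in [f] and [h] in the diagonal; [h >= 1] makes the three elements
   of [J] distinct. *)
pose j0 := Ordinal (hN : h < N.+1)%N.
have x2j : lift ord0 ord0 \notin [set lift ord0 j0].
  by rewrite inE (inj_eq lift_inj) -val_eqE /= eq_sym -lt0n.
have x1j : ord0 \notin lift ord0 (ord0 : 'I_N.+1) |: [set lift ord0 j0] by rewrite !inE.
have [P] := diag_annihilator (L := fun i => L i) char0 (Lf' j0).
rewrite -setUA !(big_setU1 _ x1j) !(big_setU1 _ x2j) !big_set1 /=.
rewrite /bump leq0n => -[P0 Pf degP ordP].
exists P; split=> //.
  by apply: leq_trans degP (leq_trans (degree_bound _ _) _); apply: eq_leq; ring.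
by apply: leq_trans ordP _; apply: eq_leq; ring.
Qed.
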